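(* Let $\Omega$ be a finite set, let $\mathcal C$ be the set of all functions from the power set of $\Omega$ to $\mathbb R$ (credence functions), and let $\mathcal P\subseteq\mathcal C$ be the set of probability functions on $\Omega$. Let $M$ be a finite real number and let $s:\mathcal P\to[-\infty,M]^\Omega$ be a proper scoring rule on $\mathcal P$. Then the following conditions are equivalent: (a) for every extension of $s$ to a quasi-strictly proper scoring rule $s':\mathcal C\to[-\infty,M]^\Omega$ (so $s'(p)=s(p)$ for $p\in\mathcal P$), if $c\in\mathcal C\setminus\mathcal P$, then there is a $p\in\mathcal P$ such that $s'(p)=s(p)$ strictly dominates $s'(c)$; (b) either $E_p s(p)$ is infinite for some $p\in\mathcal P$, or both of the following hold: (i) for any sequence $(p_n)$ in $\mathcal P$ converging to some $p\in\mathcal P$ such that $s(p_n)$ is finite for all $n$ while $s(p)$ is not finite, we have $\lim_n E_{p_n}s(p_n)=E_p s(p)$; (ii) if $F=s[\mathcal P]\cap\mathbb R^\Omega$ is the set of finite scores, then $F$ is dense in $\partial^+\operatorname{Conv}F$.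
   Context: An (accuracy) scoring rule is a function $s$ from a set $\mathcal F$ with $\mathcal P\subseteq\mathcal F\subseteq\mathcal C$ to $[-\infty,M]^\Omega$ for some finite $M$, where $A^B$ denotes the set of functions $B\to A$. For $p\in\mathcal P$ and $f:\Omega\to[-\infty,\infty]$, $E_p f=\sum_{\omega\in\Omega,\,p(\{\omega\})\neq0}p(\{\omega\})f(\omega)$. The rule $s$ is proper on $\mathcal F$ if $E_p s(p)\ge E_p s(c)$ for all $p\in\mathcal P$, $c\in\mathcal F$; strictly proper if the inequality is strict whenever $c\ne p$; quasi-strictly proper if it is proper and the inequality is strict whenever $p\in\mathcal P$ and $c\in\mathcal F\setminus\mathcal P$. A score $z\in[-\infty,M]^\Omega$ is finite if $|z(\omega)|<\infty$ for all $\omega$. A score $s(c_2)$ strictly dominates $s(c_1)$ if $s(c_2)(\omega)>s(c_1)(\omega)$ for all $\omega\in\Omega$. $\mathcal P$ carries the topology in which $p_n\to p$ iff $p_n(\{\omega\})\to p(\{\omega\})$ for all $\omega$. On $\mathbb R^\Omega$, $\langle f,g\rangle=\sum_\omega f(\omega)g(\omega)$. A boundary point $z$ of a set $G\subseteq\mathbb R^\Omega$ is positive-facing if there is $v\in(0,\infty)^\Omega$ with $\langle v,w\rangle\le\langle v,z\rangle$ for all $w\in G$; $\partial^+G$ is the set of positive-facing boundary points. $\operatorname{Conv}F$ is the convex hull of $F$. Density of $F$ in $B$ means every open set of $\mathbb R^\Omega$ meeting $B$ meets $F$. *)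

(* Defs.v *)
From HB Require Import structures.
From mathcomp Require Import all_boot all_order all_algebra.
From mathcomp Require Import all_classical all_reals all_analysis.
Set Implicit Arguments. Unset Strict Implicit. Unset Printing Implicit Defensive.
Import Order.TTheory GRing.Theory Num.Theory.
Local Open Scope classical_set_scope.
Local Open Scope ring_scope.

Section ScoringDefs.
Variables (R : realType) (T : finType).

Definition credence := {set T} -> R.

Definition is_prob (c : credence) : Prop :=
  (forall A : {set T}, 0 <= c A) /\ c (finset.setTfor T) = 1 /\
  (forall A B : {set T}, A :&: B = finset.set0 -> c (A :|: B) = c A + c B).

(* scores: elements of [-oo, +oo]^Omega; the bound by M is a separate hyp *)
Definition score := T -> \bar R.

Definition Exp (p : credence) (f : score) : \bar R :=
  (\sum_(w | p (finset.set1 w) != 0%R) (p (finset.set1 w))%:E * f w)%E.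

Definition finite_score (z : score) : Prop := forall w, z w \is a fin_num.

Definition bounded_by (M : R) (z : score) : Prop := forall w, (z w <= M%:E)%E.

Definition proper_on_P (s : credence -> score) : Prop :=
  forall p c, is_prob p -> is_prob c -> (Exp p (s c) <= Exp p (s p))%E.

Definition quasi_strictly_proper (s : credence -> score) : Prop :=
  (forall p c, is_prob p -> (Exp p (s c) <= Exp p (s p))%E) /\
  (forall p c, is_prob p -> ~ is_prob c -> (Exp p (s c) < Exp p (s p))%E).

Definition strictly_dominates (z2 z1 : score) : Prop :=
  forall w, (z1 w < z2 w)%E.

(* Euclidean topology on R^Omega (via sup-norm balls) *)
Definition sball (z : T -> R) (e : R) : set (T -> R) :=
  [set w | forall i, `|w i - z i| < e].

Definition open_RO (U : set (T -> R)) : Prop :=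
  forall x, U x -> exists2 e, 0 < e & sball x e `<=` U.

Definition boundary_point (G : set (T -> R)) (z : T -> R) : Prop :=
  forall e, 0 < e -> (sball z e `&` G !=set0) /\ (sball z e `&` ~` G !=set0).

Definition inner (f g : T -> R) : R := \sum_w f w * g w.

Definition pos_facing_boundary (G : set (T -> R)) : set (T -> R) :=
  [set z | boundary_point G z /\
     exists v : T -> R, (forall w, 0 < v w) /\ forall w, G w -> inner v w <= inner v z].

Definition conv_hull (F : set (T -> R)) : set (T -> R) :=
  [set z | exists (n : nat) (x : 'I_n -> T -> R) (l : 'I_n -> R),
     (forall i, F (x i)) /\ (forall i, 0 <= l i) /\ \sum_i l i = 1 /\
     forall w, z w = \sum_i l i * x i w].

Definition dense_in (F B : set (T -> R)) : Prop :=
  forall U, open_RO U -> U `&` B !=set0 -> U `&` F !=set0.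

Definition finite_scores (s : credence -> score) : set (T -> R) :=
  [set z | exists p, is_prob p /\ forall w, s p w = (z w)%:E].

End ScoringDefs.

(* Main.v *)
(** If some [Exp p (s p)] is infinite, no quasi-strictly proper extension
    exists.  Otherwise the score of a non-probability credence can be any [z]
    with [Exp p z < Exp p (s p)] for all [p], so (a) says that every such [z]
    is strictly dominated by some [s p].

    Let [F] be the set of finite scores.  Condition (i) amounts to
    [Exp p (s p)] being the support function of [F] on the simplex: if it
    exceeds the support function at [p], then [s p - d] on the support of [p]
    and [-oo] elsewhere is undominated.  Density (ii) is necessary because [z0 - d]
    is dominated only by scores close to the positive-facing boundary point [z0].

    Conversely, given [z], compactness of the simplex lets us replace [z] by a
    finite score lying below the support function of [F] with a uniform gap.
    A minimiser over the closure of the convex hull of [F] of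
    [\sum_i expR (- lam * (x i - z i))] is then a positive-facing boundary
    point strictly above [z], and (ii) provides a finite score near it.
    Limits of bounded sequences are taken along an ultrafilter. *)

Require Import Defs.
From HB Require Import structures.
From mathcomp Require Import all_boot all_order all_algebra.
From mathcomp Require Import all_classical all_reals all_analysis.
From mathcomp Require Import ring lra.
Import Order.TTheory GRing.Theory Num.Theory numFieldNormedType.Exports.
Local Open Scope classical_set_scope.
Local Open Scope ring_scope.

(** * Limits along filters and ultrafilters *)

Lemma cvg_expR (R : realType) (J : Type) (F : set_system J) (f : J -> R) (l : R) :
  Filter F -> f n @[n --> F] --> l -> expR (f n) @[n --> F] --> expR l.
Proof. by move=> FF fl; apply: cvg_comp fl _; exact: continuous_expR. Qed.

(** The image ultrafilter has a cluster point in the compact segment, and an ultrafilter converges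
    to each of its cluster points. *)
Lemma ultra_cvg_bounded (R : realType) (U : set_system nat) (x : nat -> R) (a b : R) :
  UltraFilter U -> (forall n, a <= x n <= b) -> exists l : R, x @ U --> l.
Proof.
move=> UU xab; have PU : ProperFilter U by exact: ultra_proper.
have [|l [_ lcl]] := @segment_compact R a b (x @ U) _.
  by apply: nearW => n /=; rewrite in_itv /=.
exists l => B lB; have [//|/= nB] := in_ultra_setVsetC (x @^-1` B) UU.
by have [y [/= nBy By]] := lcl (~` B) B nB lB.
Qed.

Lemma cvg_sum (R : realType) (I : finType) (J : Type) (F : set_system J)
    (f : J -> I -> R) (g : I -> R) : Filter F ->
  (forall i, f n i @[n --> F] --> g i) ->
  \sum_i f n i @[n --> F] --> \sum_i g i.
Proof.
move=> FF fg; elim: (index_enum I) => [|i r IH].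
  by under eq_fun do rewrite big_nil; rewrite big_nil; exact: cvg_cst.
by under eq_fun do rewrite big_cons; rewrite big_cons; exact: cvgD.
Qed.

(** * Probability vectors, inner products and convex hulls *)

Section Weights.
Variables (R : realType) (T : finType).
Implicit Types (p : credence R T) (q v z x : T -> R) (f : score R T).

(** Expectations only see point masses, so probability functions are handled as vectors of the
    simplex; [prob_of] goes back. *)
Definition weight p : T -> R := fun w => p (finset.set1 w).

Definition simplex q := (forall i, 0 <= q i) /\ \sum_i q i = 1.

Definition prob_of q : credence R T := fun A => \sum_(i in A) q i.

Lemma weight_prob_of q : weight (prob_of q) = q.
Proof. by apply/funext => i; rewrite /weight /prob_of finset.big_set1. Qed.

Lemma prob_of_is_prob q : simplex q -> is_prob (prob_of q).
Proof.
move=> [q0 q1]; split; [|split].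
- by move=> A; apply: sumr_ge0.
- by rewrite /prob_of -q1; apply: eq_bigl => i; rewrite inE.
- move=> A B AB0; rewrite /prob_of (finset.big_setID A) /=; congr (_ + _).
    by apply: eq_bigl => i; rewrite !inE orbC; case: (_ \in A); rewrite ?orbT ?andbF.
  apply: eq_bigl => i; rewrite !inE; have := finset.in_set0 i.
  by rewrite -AB0 inE; case: (i \in A); case: (i \in B).
Qed.

Lemma weight_simplex p : is_prob p -> simplex (weight p).
Proof.
move=> [p0 [p1 pU]]; split=> [i|]; first exact: p0.
have pe : p finset.set0 = 0.
  have := pU finset.set0 finset.set0 (finset.setI0 _).
  by rewrite finset.setU0 => /eqP; rewrite -subr_eq subrr => /eqP.
(* Finite additivity, adding one point at a time along a duplicate-free list. *)
have ps (r : seq T) : uniq r -> p [set x in r]%SET = \sum_(i <- r) weight p i.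
  elim: r => [|a r IH] /=.
    by move=> _; rewrite big_nil -pe; congr p; apply/finset.setP => i; rewrite !inE.
  case/andP=> ar ur; rewrite big_cons -IH // -pU.
    by congr p; apply/finset.setP => i; rewrite !inE.
  apply/finset.setP => i; rewrite !inE.
  by case: eqP => //= ->; rewrite (negbTE ar).
rewrite -big_enum -ps ?enum_uniq // -p1; congr p.
by apply/finset.setP => i; rewrite !inE mem_enum.
Qed.

Lemma Exp_finite p z : Exp p (fun w => (z w)%:E) = (inner (weight p) z)%:E.
Proof.
rewrite /Exp /inner -sumEFin big_mkcond /=; apply: eq_bigr => i _.
by case: eqP => //= e; rewrite /weight e mul0r.
Qed.

Lemma innerDr v x z : inner v (fun i => x i + z i) = inner v x + inner v z.
Proof. by rewrite /inner -big_split; apply: eq_bigr => i _; rewrite mulrDr. Qed.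

Lemma inner_cst v (a : R) : inner v (fun=> a) = (\sum_i v i) * a.
Proof. by rewrite /inner mulr_suml. Qed.

Lemma inner_scaler v x (a : R) : inner v (fun i => a * x i) = a * inner v x.
Proof. by rewrite /inner mulr_sumr; apply: eq_bigr => i _; rewrite mulrCA. Qed.

Lemma inner_scalel v x (a : R) : inner (fun i => a * v i) x = a * inner v x.
Proof. by rewrite /inner mulr_sumr; apply: eq_bigr => i _; rewrite mulrA. Qed.

Lemma innerDl v q x : inner (fun i => v i + q i) x = inner v x + inner q x.
Proof. by rewrite /inner -big_split; apply: eq_bigr => i _; rewrite mulrDl. Qed.

Lemma ler_inner v x z : (forall i, 0 <= v i) -> (forall i, x i <= z i) ->
  inner v x <= inner v z.
Proof. by move=> v0 xz; apply: ler_sum => i _; apply: ler_wpM2l. Qed.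

Lemma inner_delta x i : inner (fun j => (j == i)%:R) x = x i.
Proof.
rewrite /inner (bigD1 i) //= eqxx mul1r big1 ?addr0 // => j /negbTE ->.
by rewrite mul0r.
Qed.

Lemma cvg_inner J (F : set_system J) (a b : J -> T -> R) v x : Filter F ->
  (forall i, a n i @[n --> F] --> v i) -> (forall i, b n i @[n --> F] --> x i) ->
  inner (a n) (b n) @[n --> F] --> inner v x.
Proof. by move=> FF av bx; apply: cvg_sum => i; apply: cvgM. Qed.

Lemma conv_hullS (F : set (T -> R)) : F `<=` conv_hull F.
Proof.
move=> x Fx; exists 1%N, (fun=> x), (fun=> 1); split=> //; split=> //.
by split=> [|w]; rewrite big_ord1 ?mul1r.
Qed.

Lemma conv_hull_convex (F : set (T -> R)) x z (t : R) : 0 <= t <= 1 ->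
  conv_hull F x -> conv_hull F z -> conv_hull F (fun i => x i + t * (z i - x i)).
Proof.
move=> /andP[t0 t1] [n [a [k [Fa [k0 [k1 xE]]]]]] [m [b [l [Fb [l0 [l1 zE]]]]]].
(* The two convex combinations are concatenated, with coefficients scaled by [1 - t] and [t]. *)
exists (n + m)%N, (fun i => match fintype.split i with inl i => a i | inr j => b j end),
  (fun i => match fintype.split i with inl i => (1 - t) * k i | inr j => t * l j end).
split; first by move=> i; case: (fintype.split i).
split.
  by move=> i; case: (fintype.split i) => j; rewrite mulr_ge0 // subr_ge0.
have sl (i : 'I_n) : fintype.split (lshift m i) = inl i by exact: (unsplitK (inl i)).
have sr (i : 'I_m) : fintype.split (rshift n i) = inr i by exact: (unsplitK (inr i)).
split.
  rewrite big_split_ord /=; under eq_bigr do rewrite sl.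
  by under [X in _ + X]eq_bigr do rewrite sr; rewrite -!mulr_sumr k1 l1; ring.
move=> w; rewrite big_split_ord /=; under eq_bigr do rewrite sl -mulrA.
under [X in _ = _ + X]eq_bigr do rewrite sr -mulrA.
by rewrite -!mulr_sumr -xE -zE; ring.
Qed.

Lemma conv_hull_inner_le (F : set (T -> R)) v (b : R) :
  (forall x, F x -> inner v x <= b) -> forall x, conv_hull F x -> inner v x <= b.
Proof.
move=> Fb x [n [a [k [Fa [k0 [k1 xE]]]]]].
have -> : inner v x = \sum_i k i * inner v (a i).
  rewrite /inner; under eq_bigr do rewrite xE mulr_sumr.
  rewrite exchange_big /=; apply: eq_bigr => i _; rewrite mulr_sumr.
  by apply: eq_bigr => j _; rewrite mulrCA.
rewrite -[b]mul1r -k1 mulr_suml; apply: ler_sum => i _.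
by apply: ler_wpM2l => //; apply: Fb.
Qed.

End Weights.

(** * Positive-facing boundary points above a given vector *)

Section Pareto.
Variables (R : realType) (T : finType).

(* Minimising the soft-min penalty [Phi] over [G] makes its negated gradient
   [v] a positive outer normal, and a large [lam] puts the minimiser above [z]. *)
Lemma pos_facing_above (w0 : T) (G : set (T -> R)) (z : T -> R) (M delta : R) :
  (forall x y (t : R), 0 <= t <= 1 -> G x -> G y ->
     G (fun i => x i + t * (y i - x i))) ->
  (forall x, G x -> forall i, x i <= M) -> 0 < delta ->
  (forall p, simplex R T p -> exists2 w, G w & inner p z + delta <= inner p w) ->
  exists2 x, pos_facing_boundary G x & forall i, z i < x i.
Proof.
move=> Gcvx GM d0 Gz.
have [g0 Gg0] : G !=set0.
  have [|w Gw _] := Gz (fun j => (j == w0)%:R); last by exists w.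
  split=> [i|]; first exact: ler0n.
  by rewrite (bigD1 w0) //= eqxx big1 ?addr0 // => j /negbTE ->.
(* Chosen so that [#|T|] terms of size [lam^-1] add up to strictly less than [delta]. *)
pose lam : R := #|T|.+1%:R / delta.
have lam0 : 0 < lam by rewrite divr_gt0.
pose Phi (x : T -> R) := \sum_i expR (- lam * (x i - z i)).
have Phi_cvg (J : Type) (U : set_system J) (a : J -> T -> R) x : Filter U ->
    (forall i, a n i @[n --> U] --> x i) -> Phi (a n) @[n --> U] --> Phi x.
  move=> FU ax; apply: cvg_sum => i.
  apply: cvg_expR.
  by apply: cvgMr; apply: cvgB => //; exact: cvg_cst.
pose I := inf (Phi @` G).
have Ihas : has_inf (Phi @` G).
  split; first by exists (Phi g0), g0.
  by exists 0 => _ [x _ <-]; apply: sumr_ge0 => i _; exact: expR_ge0.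
have IPhi x : G x -> I <= Phi x by move=> Gx; apply: ge_inf; [case: Ihas|exists x].
have /choice[a aP] (n : nat) : exists x, G x /\ Phi x < I + n.+1%:R^-1.
  have [|_ [x Gx <-] lt] := @inf_adherent R (Phi @` G) n.+1%:R^-1 _ Ihas; first by rewrite invr_gt0.
  by exists x.
have [U [UU leU]] := @ultraFilterLemma nat \oo _.
have PU : ProperFilter U by exact: ultra_proper.
(* The minimising sequence is bounded: above by [M], below because each term of [Phi] is at most
   [I + 1] and [1 + u <= expR u]. *)
have /choice[x ax] i : exists l : R, a n i @[n --> U] --> l.
  apply: (@ultra_cvg_bounded _ _ _ (z i - (I + 1) / lam) M) => // n.
  have [Ga aI] := aP n; rewrite (GM _ Ga) andbT.
  have : expR (- lam * (a n i - z i)) <= I + 1.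
    apply: le_trans (le_trans (ltW aI) _).
      by rewrite /Phi (bigD1 i) //= lerDl; apply: sumr_ge0 => j _; exact: expR_ge0.
    by rewrite lerD2l invf_le1 ?ler1n.
  move/(le_trans (expR_ge1Dx _)) => h.
  have : - lam * (a n i - z i) <= I + 1 by lra.
  rewrite mulNr -mulrN mulrC -ler_pdivlMr //; lra.
have PhixI : Phi x <= I.
  apply: (ler_cvg_to (Phi_cvg _ _ _ _ _ ax) (_ : I + n.+1%:R^-1 @[n --> U] --> I)).
    rewrite -[X in _ --> X]addr0; apply: cvgD; first exact: cvg_cst.
    by apply: cvg_trans (cvg_harmonic (R := R)) => A /leU.
  by apply: nearW => n; apply: ltW; case: (aP n).
pose v i := expR (- lam * (x i - z i)).
have v0 i : 0 < v i by exact: expR_gt0.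
have foc w : G w -> inner v w <= inner v x.
  move=> Gw.
  (* First-order optimality without derivatives: [expR u - 1 <= u * expR u] bounds the increment of
     [Phi] on the segment towards [w], and [lam * t] is divided out. *)
  have step (t : R) : 0 < t <= 1 ->
      0 <= \sum_i v i * ((x i - w i) * expR (- lam * (t * (w i - x i)))).
    move=> /andP[t0 t1].
    have : I <= Phi (fun i => x i + t * (w i - x i)).
      (* The limit [x] may lie outside [G], so the points [a n] are moved towards [w] and the limit
         is taken afterwards. *)
      apply: (cvgr_to_ge (Phi_cvg _ U (fun n i => a n i + t * (w i - a n i)) _ _ _)).
        move=> i; apply: cvgD => //; apply: cvgMr; apply: cvgB => //; exact: cvg_cst.
      by apply: nearW => n; apply: IPhi; apply: Gcvx; rewrite ?(ltW t0) //; case: (aP n).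
    move/(le_trans PhixI); rewrite -subr_ge0 /Phi -sumrB => h.
    rewrite -(pmulr_rge0 _ (mulr_gt0 lam0 t0)).
    apply: le_trans h _; rewrite mulr_sumr; apply: ler_sum => i _.
    set u := - lam * (t * (w i - x i)).
    have -> : - lam * (x i + t * (w i - x i) - z i) = - lam * (x i - z i) + u.
      by rewrite /u; ring.
    have -> : lam * t * (v i * ((x i - w i) * expR u)) = v i * (u * expR u).
      by rewrite /u; ring.
    rewrite expRD -/(v i) -[X in _ - X]mulr1 -mulrBr ler_pM2l //.
    have := expR_ge1Dx (- u); rewrite expRN => h.
    have := ler_wpM2r (expR_ge0 u) h; rewrite mulVf ?gt_eqF ?expR_gt0 //; lra.
  have -> : (inner v w <= inner v x) = (0 <= \sum_i v i * (x i - w i)).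
    by rewrite -subr_ge0 /inner -sumrB; under eq_bigr do rewrite -mulrBr.
  (* Now [t] tends to 0 along [n.+1%:R^-1], and the exponential factor tends to 1. *)
  have lim0 i : - lam * (n.+1%:R^-1 * (w i - x i)) @[n --> \oo] --> (0 : R).
    rewrite -(mulr0 (- lam)); apply: cvgMr; rewrite -(mul0r (w i - x i)).
    by apply: cvgMl; exact: cvg_harmonic.
  apply: (cvgr_to_ge (F := \oo) (f := fun n => \sum_i
     v i * ((x i - w i) * expR (- lam * (n.+1%:R^-1 * (w i - x i)))))).
    apply: cvg_sum => i; apply: cvgMr; rewrite -[X in _ --> X]mulr1; apply: cvgMr.
    rewrite -[X in _ --> X]expR0; apply: cvg_expR; exact: lim0.
  by apply: nearW => n; apply: step; rewrite invr_gt0 ltr0n /= invf_le1 ?ler1n.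
exists x.
  split; last by exists v.
  move=> e e0; split.
    have : \forall n \near U, forall i, `|a n i - x i| < e.
      apply: filter_forall => i; have /cvgrPdist_lt/(_ e e0) := ax i.
      by apply: filterS => n; rewrite distrC.
    by move=> /filter_ex[n an]; exists (a n); split=> //; case: (aP n).
  (* Raising every coordinate increases the inner product with [v], which [foc] forbids inside
     [G]. *)
  exists (fun i => x i + e / 2); split.
    by move=> i; rewrite addrC addKr gtr0_norm ?divr_gt0 // ltr_pdivrMr //; lra.
  move/foc; rewrite innerDr gerDl inner_cst.
  have : 0 < \sum_i v i.
    by rewrite (bigD1 w0) //=; apply: ltr_wpDr => //; apply: sumr_ge0 => i _; exact: ltW.
  by move=> s0; rewrite pmulr_rle0 // leNgt divr_gt0.
have sv0 : 0 < \sum_i v i.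
  by rewrite (bigD1 w0) //=; apply: ltr_wpDr => //; apply: sumr_ge0 => i _; exact: ltW.
(* The gap hypothesis at the normalised [v], together with [foc], makes the [v]-weighted sum of
   [x i - (z i + delta)] nonnegative. *)
have [|w Gw] := Gz (fun i => (\sum_i v i)^-1 * v i).
  split=> [i|]; first by rewrite mulr_ge0 // ?invr_ge0 ltW.
  by rewrite -mulr_sumr mulVf ?gt_eqF.
rewrite !inner_scalel => h j; rewrite ltNge; apply/negP => xzj.
have : inner v z + (\sum_i v i) * delta <= inner v x.
  apply: le_trans (foc _ Gw).
  have := ler_wpM2l (ltW sv0) h.
  by rewrite mulrDr !mulrA mulfV ?gt_eqF // !mul1r.
rewrite -inner_cst -innerDr -subr_ge0 /inner -sumrB.
under eq_bigr do rewrite -mulrBr.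
apply/negP; rewrite -ltNge (bigD1 j) //=.
(* If [x j <= z j], then [v j >= 1] and term [j] is at most [- delta]. Every other term is at most
   [lam^-1], so the sum would be negative. *)
have hj : v j * (x j - (z j + delta)) <= - delta.
  have : 1 <= v j.
    by rewrite -expR0 ler_expR mulNr oppr_ge0 pmulr_rle0 // subr_le0.
  move=> v1; nra.
have hi i : v i * (x i - (z i + delta)) <= lam^-1.
  set d := x i - z i; have -> : x i - (z i + delta) = d - delta by rewrite /d; ring.
  have [d1|d1] := leP d delta.
    apply: (@le_trans _ _ 0); last by rewrite invr_ge0 ltW.
    by rewrite pmulr_rle0 // subr_le0.
  rewrite -[leRHS]mul1r ler_pdivlMr // mulrAC -mulrA.
  have : lam * (d - delta) <= expR (lam * d).
    apply: le_trans (ltW (ltr_pwDl (ltr01) (lexx _))) _.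
    apply: le_trans (expR_ge1Dx _) _; rewrite ler_expR ler_pM2l //; lra.
  move=> h1; apply: le_trans (ler_wpM2l (ltW (v0 i)) h1) _.
  by rewrite /v -/d -expRD mulNr addNr expR0.
have : \sum_(i | i != j) v i * (x i - (z i + delta)) <= #|T|%:R * lam^-1.
  apply: (@le_trans _ _ (\sum_(i | i != j) lam^-1)); first exact: ler_sum.
  rewrite sumr_const -[leLHS]mulr_natl ler_wpM2r ?invr_ge0 ?(ltW lam0) //.
  by rewrite ler_nat max_card.
have : #|T|%:R * lam^-1 < delta.
  rewrite /lam invf_div mulrA ltr_pdivrMr ?ltr0n // mulrC ltr_pM2l // ltr_nat.
  exact: ltnSn.
lra.
Qed.

End Pareto.

(** The default value 1 of the minimum keeps the bound positive even for empty [T]. *)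
Lemma pos_fun_lbound (R : realType) (T : finType) (d : T -> R) :
  (forall i, 0 < d i) -> exists2 m, 0 < m & forall i, m <= d i.
Proof.
move=> d0; exists (\big[Order.min/1]_i d i); first exact: lt_bigmin.
by move=> i; exact: bigmin_le.
Qed.

(** * Expectations of scores that may take the value minus infinity *)

Section Expectation.
Variables (R : realType) (T : finType) (M : R).

(** The bound [M] excludes plus infinity, so only a charged point of score [-oo] makes the
    expectation infinite. At null points the default value of [fine] is multiplied by zero. *)
Lemma Exp_cases (p : credence R T) (f : score R T) :
  is_prob p -> bounded_by M f ->
  ((exists2 i, weight R T p i != 0 & f i = -oo%E) /\ Exp p f = -oo%E) \/
  ((forall i, weight R T p i != 0 -> f i \is a fin_num) /\
   Exp p f = (inner (weight R T p) (fun i => fine (f i)))%:E).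
Proof.
move=> pP fM; have [p0 _] := weight_simplex _ _ _ pP.
have fin i : f i != -oo%E -> f i \is a fin_num.
  by move=> fi; rewrite fin_numE fi /= lt_eqF // (le_lt_trans (fM i)) ?ltry.
have [[i pi fi]|nofi] := pselect (exists2 i, weight R T p i != 0 & f i = -oo%E).
  left; split; first by exists i.
  apply/esum_eqNyP; exists i; split=> //.
  by rewrite fi gt0_muleNy // lte_fin lt_neqAle eq_sym pi p0.
have ffin i : weight R T p i != 0 -> f i \is a fin_num.
  by move=> pi; apply: fin; apply/eqP => fi; apply: nofi; exists i.
right; split=> //; rewrite -Exp_finite; apply: eq_bigr => i pi.
by rewrite fineK // ffin.
Qed.

End Expectation.

(** * Extensions and domination *)

Section Domination.
Variables (R : realType) (T : finType) (M : R) (s : credence R T -> score R T).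
Hypothesis s_bnd : forall p, is_prob p -> bounded_by M (s p).
Hypothesis s_proper : proper_on_P s.
Implicit Types (p q : credence R T) (w z : T -> R).
Local Notation weight := (weight R T).
Local Notation simplex := (simplex R T).
Local Notation F := (finite_scores s).

Lemma finite_scores_ub w i : F w -> w i <= M.
Proof. by move=> [p [pP sp]]; rewrite -lee_fin -sp s_bnd. Qed.

Lemma finite_scores_fine p : is_prob p -> finite_score (s p) ->
  F (fun i => fine (s p i)).
Proof. by move=> pP fp; exists p; split=> // i; rewrite fineK. Qed.

Lemma gtNy_finite p : is_prob p -> (forall i, -oo < s p i)%E -> finite_score (s p).
Proof.
move=> pP sp i; rewrite fin_numElt sp /=.
by rewrite (le_lt_trans (s_bnd p pP i)) ?ltry.
Qed.

(** Condition (a) freed from extensions: [z] ranges over the scores that a non-probability credence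
    can receive. *)
Definition dominates_below := forall z : score R T, bounded_by M z ->
  (forall p, is_prob p -> (Exp p z < Exp p (s p))%E) ->
  exists p, is_prob p /\ strictly_dominates (s p) z.

Lemma quasi_strict_ext_dominates :
  (forall s' : credence R T -> score R T,
      (forall c, bounded_by M (s' c)) ->
      (forall p, is_prob p -> s' p = s p) ->
      quasi_strictly_proper s' ->
      forall c, ~ is_prob c ->
      exists p, is_prob p /\ strictly_dominates (s' p) (s' c))
  <-> dominates_below.
Proof.
split=> [ext z zM zs|dom s' s'M s's [_ s'q] c cP]; last first.
  have [p pP|p [pP pd]] := dom (s' c) (s'M c).
    by rewrite -[X in (_ < Exp p X)%E]s's //; exact: s'q.
  by exists p; rewrite s's.
(* Every non-probability credence receives the same score [z]. *)
pose s' c := if pselect (is_prob c) then s c else z.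
have s's p : is_prob p -> s' p = s p by rewrite /s'; case: pselect.
have s'z c : ~ is_prob c -> s' c = z by rewrite /s'; case: pselect.
pose c0 : credence R T := fun=> -1.
have c0P : ~ is_prob c0 by case=> /(_ finset.set0); rewrite oppr_ge0 ler10.
have [| |p [pP]] := ext s' _ s's _ c0 c0P.
- by move=> c; rewrite /s'; case: pselect => // cP; exact: s_bnd.
- split=> p c pP; rewrite (s's p pP); last by move=> cP; rewrite s'z //; exact: zs.
  have [cP|cP] := pselect (is_prob c); first by rewrite s's //; exact: s_proper.
  by rewrite s'z //; apply: ltW; exact: zs.
by rewrite s's // s'z // => pd; exists p.
Qed.

(** * The case where all expectations [Exp p (s p)] are finite *)

Hypothesis s_fin : forall p, is_prob p -> Exp p (s p) \is a fin_num.

Local Notation phi p := (fine (Exp p (s p))).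

Lemma inner_finite_scores_le p w : is_prob p -> F w -> inner (weight p) w <= phi p.
Proof.
move=> pP [q [qP sq]]; rewrite -lee_fin fineK ?s_fin // -Exp_finite.
by have <- : s q = (fun i => (w i)%:E); [apply/funext|exact: s_proper].
Qed.

Lemma Exp_finite_score p : is_prob p -> finite_score (s p) ->
  phi p = inner (weight p) (fun i => fine (s p i)).
Proof.
move=> pP fp; rewrite -[RHS]/(fine _%:E) -Exp_finite; congr (fine (Exp p _)).
by apply/funext => i; rewrite fineK.
Qed.

(** Only the hard half of being the supremum over [F]; the upper bound is
    [inner_finite_scores_le]. *)
Definition Exp_is_support := forall p, is_prob p -> forall r,
  r < phi p -> exists2 w, F w & r < inner (weight p) w.

Lemma dominates_dense (w0 : T) : dominates_below ->
  dense_in F (pos_facing_boundary (conv_hull F)).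
Proof.
move=> dom U Uo [z0 [Uz0 [bz0 [v [v0 vF]]]]].
have [e e0 eU] := Uo _ Uz0.
have [m m0 mv] := pos_fun_lbound R T v v0.
have v_i i : v i <= \sum_j v j.
  by rewrite (bigD1 i) //= lerDl; apply: sumr_ge0 => j _; exact: ltW.
have sv0 : 0 < \sum_j v j by exact: lt_le_trans (v0 w0) (v_i w0).
(* With this [d], lowering all coordinates by [d] costs [e / 2 * m] in the inner product with
   [v]. *)
pose d := e * m / (2 * \sum_j v j).
have d0 : 0 < d by rewrite divr_gt0 ?mulr_gt0.
have dE : (\sum_j v j) * d = e / 2 * m by rewrite /d; field; rewrite gt_eqF.
pose z i := z0 i + - d.
have d20 : 0 < d / 2 by rewrite divr_gt0.
(* A hull point within [d / 2] of [z0] lies above [z] with room to spare, so [z] inherits its bounds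
   strictly. *)
have [[g [gz0 Gg]] _] := bz0 _ d20.
have zphi p : is_prob p -> (Exp p (fun i => (z i)%:E) < Exp p (s p))%E.
  move=> pP; rewrite Exp_finite -[ltRHS]fineK ?s_fin // lte_fin.
  have [p0 p1] := weight_simplex _ _ _ pP.
  apply: lt_le_trans (conv_hull_inner_le _ _ _ _ _ _ _ Gg); last first.
    by move=> w Fw; exact: inner_finite_scores_le.
  apply: (@lt_le_trans _ _ (inner (weight p) (fun i => z0 i + - (d / 2)))).
    by rewrite !innerDr ltrD2l !inner_cst p1 !mul1r; lra.
  by apply: ler_inner => // i; have := gz0 i; rewrite ltr_norml => /andP[]; lra.
have [|p [pP pz]] := dom _ _ zphi.
  move=> i; rewrite lee_fin; apply: (@le_trans _ _ (g i)).
    by have := gz0 i; rewrite /z ltr_norml => /andP[]; lra.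
  rewrite -(inner_delta _ _ g); apply: conv_hull_inner_le Gg => w Fw.
  by rewrite inner_delta; exact: finite_scores_ub.
have fp : finite_score (s p).
  by apply: gtNy_finite => // i; apply: le_lt_trans (pz i); rewrite leNye.
have Fw := finite_scores_fine p pP fp; set w := (fun i => _) in Fw.
exists w; split=> //; apply: eU => i.
have zw j : z j < w j by rewrite -lte_fin /w fineK //; exact: pz.
(* The other coordinates of [w] fall short of [z0] by less than [d], while
   [inner v w <= inner v z0]; so coordinate [i] exceeds [z0 i] by at most [e / 2]. *)
have := vF _ (conv_hullS _ _ F _ Fw).
rewrite -subr_ge0 /inner -sumrB; under eq_bigr do rewrite -mulrBr.
rewrite (bigD1 i) //= => h.
have : \sum_(j | j != i) v j * (z0 j - w j) <= (\sum_j v j) * d.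
  apply: (@le_trans _ _ (\sum_(j | j != i) v j * d)).
    by apply: ler_sum => j _; rewrite ler_pM2l //; have := zw j; rewrite /z; lra.
  rewrite -mulr_suml ler_pM2r // [leRHS](bigD1 i) //= lerDr; exact: ltW.
rewrite dE => h1.
have hm : v i * (w i - z0 i) <= e / 2 * v i.
  apply: (@le_trans _ _ (e / 2 * m)); first by lra.
  by rewrite ler_pM2l ?divr_gt0.
have de : d < e.
  have := ler_wpM2l (ltW (divr_gt0 e0 (ltr0n R 2))) (le_trans (mv w0) (v_i w0)).
  by rewrite -dE [leRHS]mulrC ler_pM2l //; lra.
move: hm; rewrite mulrC ler_pM2r // => hm.
by rewrite ltr_norml; have := zw i; rewrite /z => hz; apply/andP; split; lra.
Qed.
Lemma dominates_support : dominates_below -> Exp_is_support.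
Proof.
move=> dom p pP r rphi; apply: contrapT => noF.
have Fr w : F w -> inner (weight p) w <= r.
  by move=> Fw; rewrite leNgt; apply/negP => rw; apply: noF; exists w.
have [[_ e]|[pfin Ep]] := Exp_cases _ _ _ _ _ pP (s_bnd p pP).
  by have := s_fin p pP; rewrite e.
rewrite Ep /= in rphi; set x := (fun i => fine (s p i)) in Ep rphi.
(* Half the gap, so that [x - d] still has expectation above [r] at [p]. *)
pose d := (inner (weight p) x - r) / 2.
have d0 : 0 < d by rewrite divr_gt0 // subr_gt0.
pose z : score R T := fun i => if weight p i != 0 then (x i + - d)%:E else -oo%E.
have zM : bounded_by M z.
  move=> i; rewrite /z; case: ifPn => [pi|_]; last exact: leNye.
  apply: le_trans (s_bnd p pP i); rewrite -[leRHS]fineK ?pfin // lee_fin /x; lra.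
(* If [q] charges a point off the support of [p], then [Exp q z] is [-oo]. Otherwise properness
   compares [s p] with [s q] and [d] gives strictness. *)
have zphi q : is_prob q -> (Exp q z < Exp q (s q))%E.
  move=> qP; have [q0 q1] := weight_simplex _ _ _ qP.
  rewrite -[ltRHS]fineK ?s_fin //.
  have [[_ ->]|[qfin Eq]] := Exp_cases _ _ _ _ _ qP zM; first exact: ltNyr.
  have qp i : weight q i != 0 -> weight p i != 0.
    by move=> /qfin; rewrite /z; case: ifP.
  have -> : Exp q z = (inner (weight q) (fun i => x i + - d))%:E.
    rewrite Eq; congr (_%:E); apply: eq_bigr => i _.
    have [-> | qi] := eqVneq (weight q i) 0; first by rewrite !mul0r.
    by rewrite /z (qp i qi).
  rewrite lte_fin innerDr inner_cst q1 mul1r.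
  have := s_proper q p qP pP; rewrite -[leRHS]fineK ?s_fin //.
  have [[[i qi si] _]|[_ ->]] := Exp_cases _ _ _ _ _ qP (s_bnd p pP).
    by have := pfin i (qp i qi); rewrite si.
  rewrite lee_fin -/x; lra.
have [q [qP qz]] := dom z zM zphi.
have fq : finite_score (s q).
  by apply: gtNy_finite => // i; apply: le_lt_trans (qz i); rewrite leNye.
have := Fr _ (finite_scores_fine q qP fq); apply/negP; rewrite -ltNge.
have [p0 p1] := weight_simplex _ _ _ pP.
apply: (@lt_le_trans _ _ (inner (weight p) (fun i => x i + - d))).
  by rewrite innerDr inner_cst p1 mul1r /d; lra.
apply: ler_sum => i _; have [-> | pi] := eqVneq (weight p i) 0; first by rewrite !mul0r.
apply: ler_wpM2l => //; rewrite -lee_fin fineK //; apply: ltW.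
by have := qz i; rewrite /z pi.
Qed.

(** * Continuity at infinite scores and the support function *)

Definition Exp_continuous_at_infinite := forall (ps : nat -> credence R T) (p : credence R T),
  (forall n, is_prob (ps n)) -> is_prob p ->
  (forall i, (fun n => ps n (finset.set1 i)) @ \oo --> p (finset.set1 i)) ->
  (forall n, finite_score (s (ps n))) -> ~ finite_score (s p) ->
  (fun n => Exp (ps n) (s (ps n))) @ \oo --> Exp p (s p).

(** The lower estimate tests [ps n] against one finite score nearly optimal at [p]. For the upper
    one, [ps n] eventually contains [(1 - a)] times [p], and the remaining mass [a] scores at most
    [M]. *)
Lemma support_continuous : Exp_is_support -> Exp_continuous_at_infinite.
Proof.
move=> supp ps p psP pP psp psf _; rewrite -[Exp p (s p)]fineK ?s_fin //.
apply: cvg_EFin; first by apply: nearW => n; exact: s_fin.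
apply/cvgrPdist_lt => e e0.
pose x n := (fun i => fine (s (ps n) i)).
have Fx n : F (x n) by exact: finite_scores_fine.
have Ex n : phi (ps n) = inner (weight (ps n)) (x n) by exact: Exp_finite_score.
have [p0 p1] := weight_simplex _ _ _ pP.
(* Small enough that replacing mass [a] by score [M] raises the expectation by less than [e]. *)
pose a := e / (e + `|M - phi p| + 1).
have den0 : 0 < e + `|M - phi p| + 1 by rewrite ltr_wpDl // addr_ge0 // ltW.
have a0 : 0 < a by rewrite divr_gt0.
have aM : a * (M - phi p) < e.
  apply: (@le_lt_trans _ _ (a * `|M - phi p|)); first by rewrite ler_pM2l // ler_norm.
  by rewrite /a mulrAC ltr_pdivrMr // ltr_pM2l //; lra.
have a1 : a <= 1 by rewrite ler_pdivrMr // mul1r; have := normr_ge0 (M - phi p); lra.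
have [w Fw pw] := supp p pP (phi p - e) ltac:(lra).
have pnw : inner (weight (ps n)) w @[n --> \oo] --> inner (weight p) w.
  by apply: cvg_inner => // i; exact: cvg_cst.
have low : \forall n \near \oo, phi p - e < inner (weight (ps n)) w.
  exact: (cvgr_gt _ pnw).
have up : \forall n \near \oo, forall i, (1 - a) * weight p i <= weight (ps n) i.
  apply: filter_forall => i; have [-> | pi] := eqVneq (weight p i) 0.
    by apply: nearW => n; rewrite mulr0; case: (weight_simplex _ _ _ (psP n)).
  have : (1 - a) * weight p i < weight p i.
    by rewrite gtr_pMl ?lt_neqAle 1?eq_sym ?pi ?p0 //; lra.
  move=> lt; near=> n; apply: ltW; near: n; exact: (cvgr_gt _ (psp i)).
near=> n.
rewrite /= ltr_distlC; apply/andP; split.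
  have : phi p - e < inner (weight (ps n)) w by near: n.
  have := inner_finite_scores_le _ _ (psP n) Fw; lra.
have upn i : (1 - a) * weight p i <= weight (ps n) i by move: i; near: n.
rewrite Ex.
have -> : inner (weight (ps n)) (x n) = (1 - a) * inner (weight p) (x n)
   + inner (fun i => weight (ps n) i - (1 - a) * weight p i) (x n).
  by rewrite -inner_scalel -innerDl; apply: eq_bigr => i _; rewrite addrC subrK.
have : inner (fun i => weight (ps n) i - (1 - a) * weight p i) (x n) <= a * M.
  have -> : a * M = inner (fun i => weight (ps n) i - (1 - a) * weight p i) (fun=> M).
    rewrite inner_cst sumrB -mulr_sumr p1; case: (weight_simplex _ _ _ (psP n)) => _ ->.
    by ring.
  apply: ler_inner => i; first by rewrite subr_ge0.
  by apply: finite_scores_ub.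
have := ler_wpM2l (_ : 0 <= 1 - a) (inner_finite_scores_le _ _ pP (Fx n)).
by rewrite subr_ge0 => /(_ a1); lra.
Unshelve. all: end_near. Qed.

(** A finite [s p] is itself a witness. Otherwise [p] is approached by mixtures with the uniform
    distribution, whose full support forces finite scores; a bound [r] on [F] at [p] then passes to
    [phi p]. *)
Lemma continuous_support (w0 : T) : Exp_continuous_at_infinite -> Exp_is_support.
Proof.
move=> cont p pP r rphi.
have [fp|nfp] := pselect (finite_score (s p)).
  by exists (fun i => fine (s p i)); [exact: finite_scores_fine|rewrite -Exp_finite_score].
apply: contrapT => noF.
have Fr w : F w -> inner (weight p) w <= r.
  by move=> Fw; rewrite leNgt; apply/negP => rw; apply: noF; exists w.
have [p0 p1] := weight_simplex _ _ _ pP.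
pose N : R := #|T|%:R^-1.
have T0 : 0 < #|T|%:R :> R by rewrite ltr0n; apply/card_gt0P; exists w0.
have N0 : 0 < N by rewrite invr_gt0.
have N1 : \sum_(i : T) N = 1 by rewrite sumr_const -[LHS]mulr_natl mulfV // gt_eqF.
pose e n : R := n.+1%:R^-1.
have e0 n : 0 < e n by rewrite invr_gt0.
have e1 n : e n <= 1 by rewrite invf_le1 ?ler1n.
have ecvg : e n @[n --> \oo] --> (0 : R) by exact: cvg_harmonic.
pose q n i := (1 - e n) * weight p i + e n * N.
have q0 n i : 0 < q n i.
  by rewrite ltr_wpDl ?mulr_gt0 // mulr_ge0 // subr_ge0.
have qS n : simplex (q n).
  split=> [i|]; first exact: ltW.
  by rewrite big_split /= -!mulr_sumr N1 p1; ring.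
have qP n := prob_of_is_prob _ _ _ (qS n).
have qf n : finite_score (s (prob_of R T (q n))).
  have [[_ h]|[h _] i] := Exp_cases _ _ _ _ _ (qP n) (s_bnd _ (qP n)).
    by have := s_fin _ (qP n); rewrite h.
  by apply: h; rewrite weight_prob_of gt_eqF.
have := cont (fun n => prob_of R T (q n)) p qP pP _ qf nfp.
rewrite -[Exp p (s p)]fineK ?s_fin // => /(_ _)/fine_cvg qc.
have : phi p <= r.
  apply: (ler_cvg_to (qc _) (_ : (1 - e n) * r + e n * M @[n --> \oo] --> r)).
  - move=> i; have -> : (fun n => prob_of R T (q n) (finset.set1 i)) = q^~ i.
      by apply/funext => n; rewrite -[LHS]/(weight _ i) weight_prob_of.
    have <- : (1 - 0) * weight p i + 0 * N = p (finset.set1 i).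
      by rewrite mul0r addr0 subr0 mul1r.
    apply: cvgD; last exact: cvgMl.
    by apply: cvgMl; apply: cvgB => //; exact: cvg_cst.
  - rewrite -[X in _ --> X](_ : (1 - 0) * r + 0 * M = _); last by ring.
    apply: cvgD; last exact: cvgMl.
    by apply: cvgMl; apply: cvgB => //; exact: cvg_cst.
  (* The part of [q n] along [p] contributes at most [r], the uniform part at most [M]. *)
  apply: nearW => n /=; rewrite Exp_finite_score // weight_prob_of.
  have Fx := finite_scores_fine _ (qP n) (qf n); set x := (fun i => _) in Fx *.
  rewrite /q innerDl (inner_scalel _ _ (weight p)); apply: lerD.
    by apply: ler_wpM2l; [rewrite subr_ge0|exact: Fr].
  have -> : e n * M = inner (fun=> e n * N) (fun _ : T => M).
    by rewrite inner_cst -mulr_sumr N1 mulr1.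
  apply: ler_inner => i; first by rewrite mulr_ge0 ?ltW.
  exact: finite_scores_ub.
by apply/negP; rewrite -ltNge.
Qed.

(** * From support function and density to domination *)

Lemma support_dominates (w0 : T) : Exp_is_support ->
  dense_in F (pos_facing_boundary (conv_hull F)) -> dominates_below.
Proof.
move=> supp dense z zM zphi.
(* Real-valued majorants of [z], decreasing in [k]: the value [-oo] is cut off at [- k]. *)
pose zk (k : nat) i : R := if z i == -oo%E then - k%:R else fine (z i).
have zlek k i : (z i <= (zk k i)%:E)%E.
  rewrite /zk; case: eqP => [->|/eqP zi]; first exact: leNye.
  by rewrite fineK // fin_numE zi /= lt_eqF // (le_lt_trans (zM i)) ?ltry.
have zk_anti m n i : (m <= n)%N -> zk n i <= zk m i.
  by move=> mn; rewrite /zk; case: eqP => // _; rewrite lerN2 ler_nat.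
(* Compactness: if no [k] has a uniform gap, failures [a n] at level [n] with gap [n.+1%:R^-1] have
   an ultralimit [q], where the strict inequality for [z] breaks down. *)
have gap : exists k, exists2 d, 0 < d &
    forall q : T -> R, simplex q -> exists2 w, F w & inner q (zk k) + d <= inner q w.
  apply: contrapT => nogap.
  have /choice[a aP] (n : nat) : exists q : T -> R, simplex q /\
      forall w, F w -> inner q w <= inner q (zk n) + n.+1%:R^-1.
    apply: contrapT => nq; apply: nogap; exists n, n.+1%:R^-1; first by rewrite invr_gt0.
    move=> q qS; apply: contrapT => nw; apply: nq; exists q; split=> // w Fw.
    by rewrite leNgt; apply/negP => lt; apply: nw; exists w => //; exact: ltW.
  have [U [UU leU]] := @ultraFilterLemma nat \oo _.
  have PU : ProperFilter U by exact: ultra_proper.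
  have /choice[q aq] i : exists l : R, a n i @[n --> U] --> l.
    apply: (@ultra_cvg_bounded _ _ _ 0 1) => // n.
    have [[a0 <-] _] := aP n; rewrite a0 (bigD1 i) //= lerDl.
    by apply: sumr_ge0 => j _.
  have qS : simplex q.
    split=> [i|].
      by apply: (cvgr_to_ge (aq i)); apply: nearW => n; case: (aP n) => -[].
    apply: (@cvg_unique _ (@norm_hausdorff _ R) (\sum_i a n i @[n --> U])).
      exact: cvg_sum.
    rewrite (_ : (fun n => _) = fun=> 1); first exact: cvg_cst.
    by apply/funext => n; case: (aP n) => -[].
  have qP := prob_of_is_prob _ _ _ qS.
  have [w Fw zw] : exists2 w, F w & (Exp (prob_of R T q) z < (inner q w)%:E)%E.
    have := zphi _ qP; rewrite -[ltRHS]fineK ?s_fin //.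
    have [[_ ->] _|[_ ->]] := Exp_cases _ _ _ _ _ qP zM.
      (* When [Exp q z] is [-oo] any finite score will do, so the bound [phi - 1] is arbitrary. *)
      have [|w Fw _] := supp _ qP (phi (prob_of R T q) - 1); first by lra.
      by exists w => //; exact: ltNyr.
    rewrite lte_fin => /supp[//|w Fw]; rewrite weight_prob_of => lt.
    by exists w.
  (* For [n >= k] the bound at level [n] implies the one at level [k], and the error vanishes in the
     limit. *)
  have wk k : inner q w <= inner q (zk k).
    have Ucvg : inner (a n) (zk k) + n.+1%:R^-1 @[n --> U] --> inner q (zk k).
      rewrite -[X in _ --> X]addr0; apply: cvgD.
        by apply: cvg_inner => // i; exact: cvg_cst.
      by apply: cvg_trans (cvg_harmonic (R := R)) => A /leU.
    apply: (ler_cvg_to (_ : inner (a n) w @[n --> U] --> _) Ucvg).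
      by apply: cvg_inner => // i; exact: cvg_cst.
    apply: leU; exists k => // n kn; have [[a0 _] aw] := aP n.
    apply: le_trans (aw w Fw) _; rewrite lerD2r; apply: ler_inner => // i.
    exact: zk_anti.
  move: zw; have [[[i qi zi] _]|[qfin ->]] := Exp_cases _ _ _ _ _ qP zM.
    rewrite weight_prob_of in qi => _.
    have qi0 : 0 < q i by rewrite lt_neqAle eq_sym qi; case: qS => ->.
    (* When [q] charges a point [i] with score [-oo], the term at [i] alone drives [inner q (zk k)]
       below [inner q w]. *)
    have zkD k j : zk k j <= zk 0%N j + - k%:R * (j == i)%:R.
      rewrite /zk; case: (eqVneq j i) => [->|ji]; first by rewrite zi eqxx oppr0 add0r mulr1.
      rewrite mulr0 addr0; case: ifP => // _; by rewrite lerN2 ler_nat.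
    pose k := Num.bound `|(inner q (zk 0%N) - inner q w) / q i|.
    have := wk k; apply/negP; rewrite -ltNge.
    apply: (@le_lt_trans _ _ (inner q (fun j => zk 0%N j + - k%:R * (j == i)%:R))).
      by apply: ler_inner => //; case: qS.
    have -> : inner q (fun j => zk 0%N j + - k%:R * (j == i)%:R)
        = inner q (zk 0%N) - k%:R * q i.
      rewrite innerDr inner_scaler mulNr; congr (_ - _ * _).
      by rewrite -[RHS](inner_delta _ _ q) /inner; apply: eq_bigr => j _; rewrite mulrC.
    have : (inner q (zk 0%N) - inner q w) / q i < k%:R.
      by apply: le_lt_trans (ler_norm _) _; rewrite archi_boundP.
    by rewrite ltr_pdivrMr //; lra.
  rewrite weight_prob_of in qfin *; rewrite lte_fin.
  (* When [q] charges only finite values of [z], level 0 already agrees with [z] on the support of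
     [q]. *)
  apply/negP; rewrite -leNgt; apply: le_trans (wk 0%N) _; apply: ler_sum => i _.
  have [-> | qi] := eqVneq (q i) 0; first by rewrite !mul0r.
  by rewrite /zk; case: eqP (qfin i qi) => [->|].
have [k [d d0 gapd]] := gap.
have [|||x xb zx] := @pos_facing_above R T w0 (conv_hull F) (zk k) M d _ _ d0.
- by move=> x y t; exact: conv_hull_convex.
- move=> x cx i; rewrite -(inner_delta _ _ x); apply: conv_hull_inner_le cx => w Fw.
  by rewrite inner_delta; exact: finite_scores_ub.
- by move=> q /gapd[w Fw h]; exists w => //; exact: conv_hullS.
(* The vectors strictly above [zk k] form an open set containing the boundary point [x], so density
   puts a finite score there. *)
have [||y [zy [p [pP sp]]]] := dense [set y : T -> R | forall i, zk k i < y i].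
- move=> y /= zy; have [|e e0 ey] := pos_fun_lbound R T (fun i => y i - zk k i).
    by move=> i; rewrite subr_gt0.
  exists e => // y' /= yy' i; have := yy' i; have := ey i.
  by rewrite ltr_norml => h /andP[]; lra.
- by exists x.
exists p; split=> // i; rewrite sp; apply: le_lt_trans (zlek k i) _.
by rewrite lte_fin; exact: zy.
Qed.

End Domination.

(** * The equivalence of (a) and (b) *)

Theorem theorem1 (R : realType) (T : finType) (w0 : T) (M : R)
  (s : credence R T -> score R T)
  (s_bnd : forall p, is_prob p -> bounded_by M (s p))
  (s_proper : proper_on_P s) :
  (forall s' : credence R T -> score R T,
      (forall c, bounded_by M (s' c)) ->
      (forall p, is_prob p -> s' p = s p) ->
      quasi_strictly_proper s' ->
      forall c, ~ is_prob c ->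
      exists p, is_prob p /\ strictly_dominates (s' p) (s' c))
  <->
  ((exists p, is_prob p /\ ~ (Exp p (s p) \is a fin_num)) \/
   ((forall (ps : nat -> credence R T) (p : credence R T),
       (forall n, is_prob (ps n)) -> is_prob p ->
       (forall w, (fun n => ps n (finset.set1 w)) @ \oo --> p (finset.set1 w)) ->
       (forall n, finite_score (s (ps n))) -> ~ finite_score (s p) ->
       (fun n => Exp (ps n) (s (ps n))) @ \oo --> Exp p (s p)) /\
    dense_in (finite_scores s) (pos_facing_boundary (conv_hull (finite_scores s))))).
Proof.
have ext_dom := quasi_strict_ext_dominates R T M s s_bnd s_proper.
have [[p [pP pinf]]|nofin] :=
    pselect (exists p, is_prob p /\ ~ (Exp p (s p) \is a fin_num)).
  split=> [_|_ s' s'M s's [_ s'q] c cP]; first by left; exists p.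
  (* An infinite [Exp p (s p)] is [-oo], and nothing lies strictly below it; no quasi-strict
     extension exists and (a) holds vacuously. *)
  have := s'q p c pP cP; rewrite (s's p pP).
  have [[_ ->]|[_ e]] := Exp_cases _ _ _ _ _ pP (s_bnd p pP).
    by move/lt_geF; rewrite leNye.
  by case: pinf; rewrite e.
have s_fin p : is_prob p -> Exp p (s p) \is a fin_num.
  by move=> pP; apply: contrapT => pinf; apply: nofin; exists p.
split=> [/ext_dom dom|].
  right; split; last exact: (dominates_dense R T M s).
  apply: (support_continuous R T M s) => //.
  exact: (dominates_support R T M s).
case=> [[p [pP]]|[cont dense]]; first by case; exact: s_fin.
apply/ext_dom; apply: support_dominates => //.
exact: (continuous_support R T M s).
Qed.
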